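(* Let $(X,d)$ be a nonempty compact metric space, let $\lambda$ be the Banach-Mycielski content on $X$ (with respect to a non-principal ultrafilter $\mathcal F$ on the positive integers) and let $\mu$ be the associated Banach-Mycielski probability measure. If $X$ is regular (i.e. $\mathrm{sing}(F)=0$ for every closed $F\subset X$), then $\mu$ is a countably additive congruence-invariant measure: $\mu(\sigma(B))=\mu(B)$ for every Borel set $B\subset X$ and every congruence $\sigma$ defined on $B$.
   Context: A congruence in $X$ is an isometry (distance-preserving map) $\sigma:A\to\sigma(A)\subset X$ defined on a subset $A\subset X$; it need not extend to $X$. For compact $C\subset X$ and $t\in(0,1]$, $E(C,t)$ is the minimal cardinality of a covering of $C$ by sets all of diameter less than $t$. For a non-principal ultrafilter $\mathcal F$ on the positive integers, the Banach-Mycielski content of a compact $K\subset X$ is $\lambda(K)=\lim_{n\to\mathcal F} E(K,\frac1n)/E(X,\frac1n)$ (ultrafilter limit in $[0,\infty]$). For $U\subset X$ open put $\mu_0(U)=\sup\{\lambda(K):K\subset U,\ K \text{ closed}\}$, and for $A\subset X$ put $\mu^*(A)=\inf\{\mu_0(U):A\subset U,\ U\text{ open}\}$; $\mu^*$ is an outer measure, and the Borel probability measure $\mu$ obtained from it by Carathéodory's theorem (the restriction of $\mu^*$ to Borel sets) is the Banach-Mycielski measure. For closed $F\subset X$ let $\overline{K(F,\frac1n)}=\{x\in X:d(x,F)\le\frac1n\}$, with $d(x,F)=\inf_{y\in F}d(x,y)$, and define the singularity $\mathrm{sing}(F)=\lim_{n\to\infty}\lambda(\overline{K(F,\frac1n)})-\lambda(F)$.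 *)

(* Defs.v *)
From HB Require Import structures.
From mathcomp Require Import all_boot all_order all_algebra.
From mathcomp Require Import all_classical all_reals all_analysis.

Set Implicit Arguments.
Unset Strict Implicit.
Unset Printing Implicit Defensive.

Import Order.TTheory GRing.Theory Num.Theory.

Local Open Scope classical_set_scope.
Local Open Scope ring_scope.

(* The base point only records that the space is nonempty. It is needed by the
   library to put a Borel sigma-algebra on the carrier. *)
#[short(type="pmetricType")]
HB.structure Definition PointedMetric (K : numDomainType) :=
  {M of Metric K M & isPointed M}.

Section BanachMycielski.
Context {R : realType} {X : metricType R}.
Implicit Types (A B C K U : set X) (t : R) (x y : X).

(* The adjoined 0 only matters for the empty set, which gets diameter 0. *)
Definition diameter A : \bar R :=
  ereal_sup ([set 0%E] `|` [set (mdist z.1 z.2)%:E | z in A `*` A]).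

Definition coverable C t (k : nat) : Prop :=
  exists G : set (set X),
    [/\ (G #= `I_k)%card, C `<=` \bigcup_(A in G) A
      & forall A, G A -> (diameter A < t%:E)%E].

(* The value 0 is a default for sets having no finite covering of this kind,
   which are never compact when 0 < t. *)
Definition cover_number C t : nat :=
  xget 0%N [set k | coverable C t k /\ forall j, coverable C t j -> (k <= j)%N].

(* Filters on the positive integers are represented as filters on nat, the
   index n standing for the positive integer n.+1. *)
Definition nonprincipal (F : set_system nat) : Prop :=
  forall n, F <> principal_filter n.

Definition BM_content (F : set_system nat) K : \bar R :=
  lim ((fun n : nat => ((cover_number K n.+1%:R^-1)%:R /
                  (cover_number [set: X] n.+1%:R^-1)%:R : R)%:E) @ F).

Definition open_content (F : set_system nat) U : \bar R :=
  ereal_sup [set BM_content F K | K in [set K | closed K /\ K `<=` U]].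

Definition outer_content (F : set_system nat) A : \bar R :=
  ereal_inf [set open_content F U | U in [set U | open U /\ A `<=` U]].

(* Extended-real valued, so that the distance to the empty set is +oo and its
   closed neighbourhoods are empty. *)
Definition set_dist x A : \bar R := ereal_inf [set (mdist x y)%:E | y in A].

Definition closed_nbhd A (r : R) : set X := [set x | (set_dist x A <= r%:E)%E].

Definition sing (F : set_system nat) A : \bar R :=
  (limn (fun n : nat => BM_content F (closed_nbhd A n.+1%:R^-1)) - BM_content F A)%E.

(* A congruence with domain A is represented by a total map of which only the
   values on A matter. *)
Definition congruence_on A (sigma : X -> X) : Prop :=
  forall x y, A x -> A y -> mdist (sigma x) (sigma y) = mdist x y.

End BanachMycielski.

Definition BM_regular {R : realType} (X : metricType R)
    (F : set_system nat) : Prop :=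
  forall A : set X, closed A -> sing F A = 0%E.

(* Main.v *)
Require Import Defs.
From HB Require Import structures.
From mathcomp Require Import all_boot all_order all_algebra.
From mathcomp Require Import finmap.
From mathcomp Require Import all_classical all_reals all_analysis.
From mathcomp Require Import lra.

Set Implicit Arguments.
Unset Strict Implicit.
Unset Printing Implicit Defensive.

Import Order.TTheory GRing.Theory Num.Theory.
Import numFieldNormedType.Exports.

Local Open Scope classical_set_scope.
Local Open Scope ring_scope.

(* The content is monotone, subadditive, invariant under congruences, and additive
   on disjoint closed sets, since these lie at positive distance from each other
   and no small set meets both. As in Halmos' treatment of contents, it follows
   that open sets are Caratheodory measurable for the induced outer measure.
   Regularity squeezes the measure of a closed set K between the content of K and
   the contents of its closed neighbourhoods, so that measure and content agree
   on closed sets. A closed K inside B with almost the same measure is carried by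
   a congruence to a closed set with the same content, so the measure cannot
   decrease under a congruence; the inverse congruence gives equality. The image
   of B is Borel because a congruence extends to the compact closure of B. *)

(** * Covering numbers of subsets of a compact metric space *)

Section CoverNumber.
Context {R : realType} {X : pmetricType R}.
Implicit Types (A B C K L : set X) (t : R) (s : seq (set X)).

Lemma diameter_ltP A t : (diameter A < t%:E)%E ->
  forall x y, A x -> A y -> mdist x y < t.
Proof.
move=> At x y Ax Ay; rewrite -lte_fin; apply: le_lt_trans At.
by apply: ereal_sup_ubound; right; exists (x, y).
Qed.

Lemma diameter_le A t : 0 <= t ->
  (forall x y, A x -> A y -> mdist x y <= t) -> (diameter A <= t%:E)%E.
Proof.
move=> t0 At; apply: ge_ereal_sup => _ [->|[[x y] [/= Ax Ay] <-]].
  by rewrite lee_fin.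
by rewrite lee_fin At.
Qed.

Lemma diameter_image A B (sigma : X -> X) : congruence_on A sigma ->
  (diameter (sigma @` (A `&` B)) <= diameter B)%E.
Proof.
move=> sA; apply: ge_ereal_sup => _ [->|[[_ _] [/= [x [Ax Bx] <-] [y [Ay By] <-]] <-]].
  by apply: ereal_sup_ubound; left.
by rewrite sA//; apply: ereal_sup_ubound; right; exists (x, y).
Qed.

(** Covers as lists with possible repetitions: concatenating, filtering and mapping them gives
    immediate size bounds. Repetitions are removed only on returning to [coverable], which asks for
    an exact cardinality. *)
Definition seq_cover C t s :=
  (forall x, C x -> exists2 A, A \in s & A x) /\
  (forall A, A \in s -> (diameter A < t%:E)%E).

Lemma coverable_seq_cover C t k : coverable C t k ->
  exists2 s, size s = k & seq_cover C t s.
Proof.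
move=> [G [Gk CG Gt]]; have finG : finite_set G by apply/finite_setP; exists k.
exists (enum_fset (fset_set G)); first exact: card_fset_set.
split=> [x /CG[A GA Ax]|A].
  by exists A => //; rewrite in_fset_set// inE.
by rewrite in_fset_set// inE; exact: Gt.
Qed.

Lemma seq_cover_coverable C t s : seq_cover C t s ->
  coverable C t (size (undup s)).
Proof.
move=> [Cs st]; exists [set` [fset A in s]%fset]; split.
- by apply/card_eq_fsetP; rewrite card_fseq.
- by move=> x /Cs[A As Ax]; exists A => //=; rewrite !inE.
- by move=> A /=; rewrite !inE; exact: st.
Qed.

(** As soon as one finite cover exists, the well-ordering of [nat] provides a minimal size, so
    [xget] does not fall back on its default 0. *)
Lemma cover_numberP C t k : coverable C t k ->
  coverable C t (cover_number C t) /\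
  forall j, coverable C t j -> (cover_number C t <= j)%N.
Proof.
move=> Ck; have ex : exists j, `[< coverable C t j >] by exists k; apply/asboolP.
case: (ex_minnP ex) => m /asboolP Cm min.
rewrite /cover_number; case: xgetP => [j _ //|].
by move=> /(_ m); case; split=> // j Cj; apply: min; apply/asboolP.
Qed.

Lemma cover_number_le C t s : seq_cover C t s -> (cover_number C t <= size s)%N.
Proof.
move=> /seq_cover_coverable Cs; have [_ /(_ _ Cs)] := cover_numberP Cs.
by move=> /leq_trans; apply; exact: size_undup.
Qed.

Lemma cover_number0 t : cover_number (set0 : set X) t = 0%N.
Proof. by apply/eqP; rewrite -leqn0 (@cover_number_le _ _ [::])//; split. Qed.

Hypothesis X_compact : compact [set: X].

Lemma seq_cover_exists t : 0 < t -> exists s, seq_cover [set: X] t s.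
Proof.
move=> t0; have t3 : 0 < t / 3 by rewrite divr_gt0.
move: (X_compact); rewrite compact_cover => /(_ X setT
  (fun x => (ball x (t / 3))^°)) [].
- by move=> x _; exact: open_interior.
- by move=> x _; exists x => //; exact: nbhsx_ballx.
move=> D _ cD; exists [seq ball x (t / 3) | x <- enum_fset D]; split=> [x|].
  move=> /cD[y /= yD /interior_subset xy]; exists (ball y (t / 3)) => //.
  by apply/mapP; exists y.
(* Bounding pairwise distances by a constant bounds the diameter only non-strictly; the radius
   [t / 3] gives the bound [2t / 3] and so leaves room for a strict inequality. *)
move=> _ /mapP[x _ ->]; apply: (@le_lt_trans _ _ (t / 3 + t / 3)%:E); last first.
  by rewrite lte_fin; lra.
apply: diameter_le => [|y z]; first by rewrite addr_ge0// ltW.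
rewrite ballEmdist/= => xy xz; rewrite (le_trans (metric_triangle _ x _))//.
by rewrite metric_sym lerD// ltW.
Qed.

Lemma cover_number_seq C t : 0 < t ->
  exists2 s, size s = cover_number C t & seq_cover C t s.
Proof.
move=> /seq_cover_exists[s [cs ds]].
have : seq_cover C t s by split=> // x _; exact: cs.
by move=> /seq_cover_coverable /cover_numberP[/coverable_seq_cover].
Qed.

Lemma cover_number_mono A B t : 0 < t -> A `<=` B ->
  (cover_number A t <= cover_number B t)%N.
Proof.
move=> t0 AB; have [s <- [Bs st]] := cover_number_seq B t0.
by apply: cover_number_le; split=> // x /AB /Bs.
Qed.

Lemma cover_numberU A B t : 0 < t ->
  (cover_number (A `|` B) t <= cover_number A t + cover_number B t)%N.
Proof.
move=> t0; have [s <- [As st]] := cover_number_seq A t0.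
have [s' <- [Bs' s't]] := cover_number_seq B t0.
rewrite -size_cat; apply: cover_number_le; split=> [x [/As|/Bs']|C].
- by case=> C Cs Cx; exists C => //; rewrite mem_cat Cs.
- by case=> C Cs Cx; exists C => //; rewrite mem_cat Cs orbT.
- by rewrite mem_cat => /orP[/st|/s't].
Qed.

(** A set of diameter less than [t] cannot meet both [A] and [B]. The members of an optimal cover of
    the union that meet [A] and those that meet [B] therefore share no entry, and each family covers
    its own set. *)
Lemma cover_number_separated A B t : 0 < t ->
  (forall x y, A x -> B y -> t <= mdist x y) ->
  (cover_number A t + cover_number B t <= cover_number (A `|` B) t)%N.
Proof.
move=> t0 AB; have [s <- [Us st]] := cover_number_seq (A `|` B) t0.
pose meets K := [pred C : set X | `[< K `&` C !=set0 >]].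
have cov K : K `<=` A `|` B -> seq_cover K t [seq C <- s | meets K C].
  move=> KU; split=> [x Kx|C]; last by rewrite mem_filter => /andP[_ /st].
  have [C Cs Cx] := Us _ (KU _ Kx).
  by exists C => //; rewrite mem_filter Cs andbT; apply/asboolP; exists x.
rewrite (@leq_trans (size [seq C <- s | meets A C] + size [seq C <- s | meets B C]))//.
  by apply: leq_add; apply: cover_number_le; apply: cov => x; [left|right].
rewrite !size_filter -count_predUI.
rewrite (_ : count (predI _ _) s = 0%N) ?addn0 ?count_size//.
apply/eqP; rewrite -leqn0 leqNgt -has_count; apply/hasPn => C Cs /=.
apply/negP => /andP[/asboolP[x [Ax Cx]] /asboolP[y [By Cy]]].
have := AB _ _ Ax By; apply/negP; rewrite -ltNge.
exact: diameter_ltP (st _ Cs) _ _ Cx Cy.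
Qed.

(** A cover of [A] is transported by [sigma]. Its members are first cut down to [A], since [sigma]
    preserves distances only there. *)
Lemma cover_number_image A (sigma : X -> X) t : 0 < t -> congruence_on A sigma ->
  (cover_number (sigma @` A) t <= cover_number A t)%N.
Proof.
move=> t0 sA; have [s <- [As st]] := cover_number_seq A t0.
rewrite -(size_map (fun C => sigma @` (A `&` C)) s).
apply: cover_number_le; split=> [_ [x Ax <-]|].
  have [C Cs Cx] := As _ Ax; exists (sigma @` (A `&` C)); last by exists x.
  exact: map_f.
by move=> _ /mapP[C Cs ->]; apply: le_lt_trans (st _ Cs); exact: diameter_image.
Qed.

Lemma cover_number_gt0 A t : 0 < t -> A !=set0 -> (0 < cover_number A t)%N.
Proof.
move=> t0 [x Ax]; have [s <- [As _]] := cover_number_seq A t0.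
by case: s As => // /(_ _ Ax)[].
Qed.

End CoverNumber.

(** * The content as a limit along the ultrafilter *)

Section Content.
Context {R : realType} {X : pmetricType R}.
Hypothesis X_compact : compact [set: X].
Context (F : set_system nat) {F_ultra : UltraFilter F}.
Implicit Types (K L : set X).

Definition cover_ratio K (n : nat) : R :=
  (cover_number K n.+1%:R^-1)%:R / (cover_number [set: X] n.+1%:R^-1)%:R.

(** Real-valued counterpart of [BM_content]: the ratios lie in the compact interval from 0 to 1, so
    the limit is finite and the estimates can be made in [R]. *)
Definition bm K : R := lim (cover_ratio K @ F).

Let inv_gt0 n : 0 < n.+1%:R^-1 :> R.
Proof. by rewrite invr_gt0. Qed.

Let total_gt0 n : 0 < (cover_number [set: X] n.+1%:R^-1)%:R :> R.
Proof. by rewrite ltr0n cover_number_gt0//; exists point. Qed.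

Lemma cover_ratio_itv K n : 0 <= cover_ratio K n <= 1.
Proof.
rewrite divr_ge0//= ler_pdivrMr// mul1r ler_nat.
exact: cover_number_mono.
Qed.

(* A cluster point of an ultrafilter is a limit. *)
Lemma cvg_bm K : cover_ratio K @ F --> bm K.
Proof.
have [l [_ lF]] : `[(0 : R), 1]%classic `&` cluster (cover_ratio K @ F) !=set0.
  apply: segment_compact; apply: nearW => n.
  by rewrite /= in_itv/= cover_ratio_itv.
suff Fl : cover_ratio K @ F --> l by rewrite /bm (cvg_lim _ Fl).
move=> U lU; have [//|FU] := in_ultra_setVsetC (cover_ratio K @^-1` U) F_ultra.
by have [x []] := lF (~` U) U FU lU.
Qed.

Lemma is_cvg_bm K : cvg (cover_ratio K @ F).
Proof. by apply/cvg_ex; exists (bm K); exact: cvg_bm. Qed.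

Lemma BM_contentE K : BM_content F K = (bm K)%:E.
Proof. by apply: cvg_lim => //; apply: cvg_EFin; [exact: nearW|exact: cvg_bm]. Qed.

Lemma bm_ge0 K : 0 <= bm K.
Proof.
apply: limr_ge; first exact: is_cvg_bm.
by apply: nearW => n; case/andP: (cover_ratio_itv K n).
Qed.

Lemma le_bm K L : K `<=` L -> bm K <= bm L.
Proof.
move=> KL; apply: ler_lim; [exact: is_cvg_bm..|apply: nearW => n].
by rewrite ler_pM2r ?invr_gt0// ler_nat; exact: cover_number_mono.
Qed.

Lemma bm0 : bm set0 = 0.
Proof.
rewrite /bm (_ : cover_ratio set0 = fun=> 0) ?lim_cst//.
by apply/funext => n; rewrite /cover_ratio cover_number0 mul0r.
Qed.

Lemma bmT : bm setT = 1.
Proof.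
rewrite /bm (_ : cover_ratio setT = fun=> 1) ?lim_cst//.
by apply/funext => n; rewrite /cover_ratio divff// gt_eqF.
Qed.

Lemma bmU K L : bm (K `|` L) <= bm K + bm L.
Proof.
rewrite -limD; [|exact: is_cvg_bm..].
apply: ler_lim; [exact: is_cvg_bm|apply: is_cvgD; exact: is_cvg_bm|].
apply: nearW => n; rewrite /cover_ratio fctE -mulrDl.
rewrite ler_pM2r ?invr_gt0// -natrD ler_nat.
exact: cover_numberU.
Qed.

Lemma bm_bigcup_ord n (K : nat -> set X) :
  bm (\big[setU/set0]_(i < n) K i) <= \sum_(i < n) bm (K i).
Proof.
elim: n => [|n IH]; first by rewrite !big_ord0 bm0.
by rewrite !big_ord_recr/= (le_trans (bmU _ _))// lerD2r.
Qed.

Lemma bm_image K (sigma : X -> X) : congruence_on K sigma ->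
  bm (sigma @` K) <= bm K.
Proof.
move=> sK; apply: ler_lim; [exact: is_cvg_bm..|apply: nearW => n].
by rewrite ler_pM2r ?invr_gt0// ler_nat; exact: cover_number_image.
Qed.

Hypothesis F_nonprincipal : nonprincipal F.

(** An ultrafilter containing a singleton is the principal filter at its point. Hence [F] contains
    the complement of every singleton, and by finite intersection every final segment. *)
Lemma nonprincipal_ge N : \forall n \near F, (N <= n)%N.
Proof.
have FC n : F (~` [set n]).
  have [Fn|//] := in_ultra_setVsetC [set n] F_ultra.
  case: (F_nonprincipal (n := n)); apply/seteqP; split=> A.
    move=> FA; apply/principal_filterP.
    have FAn : F (A `&` [set n]) by exact: filterI.
    by have [x [Ax <-]] := filter_ex FAn.
  by move/principal_filterP => An; apply: filterS Fn => _ ->.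
elim: N => [|N IH]; first exact: nearW.
near=> n; rewrite ltn_neqAle; apply/andP; split; last by near: n.
rewrite eq_sym; apply/eqP; near: n; exact: FC.
Unshelve. all: by end_near. Qed.

(** Around each point of [K] the bound [n.+1%:R^-1] is valid for all large [n]; compactness of [K]
    makes one index serve all points. *)
Lemma closed_separated K L : closed K -> closed L -> K `&` L = set0 ->
  exists2 d : R, 0 < d & forall x y, K x -> L y -> d <= mdist x y.
Proof.
move=> cK cL KL0.
have /compact_near_coveringP KP := subclosed_compact cK X_compact (@subsetT _ K).
have [|N _ /(_ N (leqnn N)) KN] := KP nat \oo
    (fun n x => forall y, L y -> n.+1%:R^-1 <= mdist x y) _; last first.
  by exists N.+1%:R^-1 => // x y Kx Ly; exact: KN.
move=> x Kx; have : nbhs x (~` L).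
  apply: open_nbhs_nbhs; split; first exact: closed_openC.
  by move=> Lx; have : (K `&` L) x by []; rewrite KL0.
rewrite -nbhs_ballE => -[e /= e0]; rewrite ballEmdist => xL.
exists (ball x (e / 2), [set n | n.+1%:R^-1 <= e / 2]) => /=.
  split; first by apply: nbhsx_ballx; rewrite divr_gt0.
  near=> n; rewrite /= invf_ple ?posrE// ?divr_gt0//.
  apply: le_trans (ltW (truncnS_gt _)) _.
  by rewrite ler_nat ltnS; near: n; exact: nbhs_infty_ge.
(* The ball of radius [e] about [x] misses [L], so points within [e / 2] of [x] stay at distance at
   least [e / 2] from [L]. *)
move=> [x' n] /= [+ ne] y Ly; rewrite ballEmdist/= => xx'.
rewrite (le_trans ne)// leNgt; apply/negP => x'y; apply: (xL y) Ly => /=.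
by rewrite (le_lt_trans (metric_triangle _ x' _))// [ltRHS]splitr ltrD.
Unshelve. all: by end_near. Qed.

(** Once [n.+1%:R^-1] is at most the distance [d] separating the two sets, their covering numbers
    add up. Since [F] is non-principal, this concerns [F]-almost all [n]. *)
Lemma bm_disjoint K L : closed K -> closed L -> K `&` L = set0 ->
  bm K + bm L <= bm (K `|` L).
Proof.
move=> cK cL KL0; have [d d0 dKL] := closed_separated cK cL KL0.
rewrite -limD; [|exact: is_cvg_bm..].
apply: ler_lim; [apply: is_cvgD; exact: is_cvg_bm|exact: is_cvg_bm|].
near=> n; rewrite /cover_ratio fctE -mulrDl.
rewrite ler_pM2r ?invr_gt0// -natrD ler_nat.
apply: cover_number_separated => // x y Kx Ly; apply: le_trans (dKL _ _ Kx Ly).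
rewrite invf_ple ?posrE//.
apply: le_trans (ltW (truncnS_gt _)) _.
rewrite ler_nat ltnS; near: n; exact: nonprincipal_ge.
Unshelve. all: by end_near. Qed.

End Content.

(** * The outer measure induced by the content, and measurability of open sets *)

Section OuterMeasure.
Context {R : realType} {X : pmetricType R}.
Hypothesis X_compact : compact [set: X].
Context (F : set_system nat) {F_ultra : UltraFilter F}.
Hypothesis F_nonprincipal : nonprincipal F.
Implicit Types (A B K L U V : set X).
Local Open Scope ereal_scope.

Lemma bm_le_open K U : closed K -> K `<=` U -> (bm F K)%:E <= open_content F U.
Proof.
by move=> cK KU; apply: ereal_sup_ubound; exists K => //; exact: BM_contentE.
Qed.

Lemma open_content_le U x : (forall K, closed K -> K `<=` U -> (bm F K)%:E <= x) ->
  open_content F U <= x.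
Proof.
by move=> Ux; apply: ge_ereal_sup => _ [K [cK KU] <-]; rewrite BM_contentE// Ux.
Qed.

Lemma open_content_ge0 U : 0 <= open_content F U.
Proof. by rewrite (le_trans _ (bm_le_open closed0 (@sub0set _ U)))// lee_fin bm_ge0. Qed.

Lemma le_open_content U V : U `<=` V -> open_content F U <= open_content F V.
Proof.
move=> UV; apply: open_content_le => K cK KU.
by apply: bm_le_open => //; exact: subset_trans UV.
Qed.

Lemma open_content_bm U L : U `<=` L -> open_content F U <= (bm F L)%:E.
Proof.
move=> UL; apply: open_content_le => K cK KU; rewrite lee_fin.
by apply: le_bm => //; exact: subset_trans UL.
Qed.

Lemma open_content0 : open_content F (set0 : set X) = 0.
Proof.
have b0 : (bm F (set0 : set X))%:E = 0 by rewrite bm0.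
by apply/eqP; rewrite eq_le open_content_ge0 andbT -b0 open_content_bm.
Qed.

Lemma open_contentT : open_content F [set: X] = 1.
Proof.
have bT : (bm F [set: X])%:E = 1 by rewrite bmT.
by apply/eqP; rewrite eq_le -bT open_content_bm//= bm_le_open.
Qed.

(** If the ball about [x] contains a point [y] outside [U], then [y] is still within [r] of every
    point near [x], so the complement is open. *)
Lemma closed_ball_subset U (r : R) : closed [set x | ball x r `<=` U].
Proof.
rewrite -[X in closed X]setCK; apply: open_closedC; rewrite openE => x /= /existsNP[y].
move=> /not_implyP[]; rewrite ballEmdist/= => xy Uy.
rewrite /interior -nbhs_ballE; exists (r - mdist x y)%R; first by rewrite /= subr_gt0.
move=> z; rewrite ballEmdist/= => xz zU; apply/Uy/zU; rewrite ballEmdist/=.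
by rewrite (le_lt_trans (metric_triangle _ x _))// metric_sym -ltrBrDr.
Qed.

(* By compactness each point of [K] has a ball of a fixed radius inside one of
   finitely many [U i]; sorting the points by that index splits [K] into closed
   pieces. *)
Lemma open_content_sigma_subadditive (U : (set X)^nat) : (forall i, open (U i)) ->
  open_content F (\bigcup_i U i) <= \sum_(i <oo) open_content F (U i).
Proof.
move=> oU; apply: open_content_le => K cK KU.
have /compact_near_coveringP KP := subclosed_compact cK X_compact (@subsetT _ K).
have [|N _ /(_ N (leqnn N)) KN] := KP nat \oo
    (fun n x => exists2 i, (i < n)%N & ball x n.+1%:R^-1 `<=` U i) _.
  move=> x /KU[i _ Uix]; have : nbhs x (U i) by exact: open_nbhs_nbhs.
  rewrite -nbhs_ballE => -[e /= e0 xU].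
  exists (ball x (e / 2), [set n | n.+1%:R^-1 <= e / 2 /\ (i < n)%N])%R => /=.
    split; first by apply: nbhsx_ballx; rewrite divr_gt0.
    near=> n; split; last by near: n; exact: nbhs_infty_gt.
    rewrite /= invf_ple ?posrE// ?divr_gt0//.
    apply: le_trans (ltW (truncnS_gt _)) _.
    by rewrite ler_nat ltnS; near: n; exact: nbhs_infty_ge.
  move=> [x' n] /= [xx' [ne ni]]; exists i => //; apply: subset_trans xU => y x'y.
  rewrite [e]splitr; apply: ball_triangle xx' _; exact: le_ball x'y.
pose K_ i := K `&` [set x | ball x N.+1%:R^-1 `<=` U i].
have cK_ i : closed (K_ i) by apply: closedI => //; exact: closed_ball_subset.
apply: (@le_trans _ _ (\sum_(i < N) bm F (K_ i))%:E).
  rewrite lee_fin (le_trans _ (bm_bigcup_ord X_compact N K_))//.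
  apply: le_bm => // x Kx; have [i iN xU] := KN x Kx.
  by rewrite -bigcup_mkord; exists i.
rewrite -sumEFin; apply: (@le_trans _ _ (\sum_(i < N) open_content F (U i))).
  apply: lee_sum => i _; apply: bm_le_open => // x [_ /= ]; apply.
  exact: ballxx.
rewrite -(big_mkord xpredT (fun i => open_content F (U i))).
by apply: nneseries_lim_ge => i _ _; exact: open_content_ge0.
Unshelve. all: by end_near. Qed.

Lemma outer_content_le_open A U : open U -> A `<=` U ->
  outer_content F A <= open_content F U.
Proof. by move=> oU AU; apply: ereal_inf_lbound; exists U. Qed.

Lemma le_outer_content_inf A x :
  (forall U, open U -> A `<=` U -> x <= open_content F U) -> x <= outer_content F A.
Proof. by move=> Ax; apply: le_ereal_inf_tmp => _ [U [oU AU] <-]; exact: Ax. Qed.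

Lemma outer_content_ge0 A : 0 <= outer_content F A.
Proof. by apply: le_outer_content_inf => U _ _; exact: open_content_ge0. Qed.

Lemma le_outer_content : {homo outer_content (X := X) F : A B / A `<=` B >-> A <= B}.
Proof.
move=> A B AB; apply: le_outer_content_inf => U oU BU.
by apply: outer_content_le_open => //; exact: subset_trans BU.
Qed.

Lemma outer_content_open U : open U -> outer_content F U = open_content F U.
Proof.
move=> oU; apply/eqP; rewrite eq_le outer_content_le_open//=.
by apply: le_outer_content_inf => V _; exact: le_open_content.
Qed.

Lemma outer_content0 : outer_content F (set0 : set X) = 0.
Proof. by rewrite outer_content_open ?open_content0//; exact: open0. Qed.

Lemma outer_contentT : outer_content F [set: X] = 1.
Proof. by rewrite outer_content_open ?open_contentT//; exact: openT. Qed.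

Lemma outer_content_fin_num A : outer_content F A \is a fin_num.
Proof.
rewrite ge0_fin_numE ?outer_content_ge0// (@le_lt_trans _ _ 1) ?ltry//.
by rewrite -outer_contentT; exact: le_outer_content.
Qed.

Lemma outer_content_adherent A (e : R) : (0 < e)%R ->
  exists U, [/\ open U, A `<=` U & open_content F U < outer_content F A + e%:E].
Proof.
move=> /lb_ereal_inf_adherent /(_ (outer_content_fin_num A)).
by move=> [_ [U [oU AU] <-] Ue]; exists U.
Qed.

Lemma outer_content_sigma_subadditive : sigma_subadditive (outer_content (X := X) F).
Proof.
move=> A; apply/lee_addgt0Pr => e e0.
have e2 i : (0 < e / (2 ^ i.+1)%:R)%R by rewrite divr_gt0// ltr0n expn_gt0.
have /choice[U AU] := fun i => outer_content_adherent (A i) (e2 i).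
apply: (le_trans _ (epsilon_trick _ _ (ltW e0))); last by move=> *; exact: outer_content_ge0.
apply: (@le_trans _ _ (\sum_(i <oo) open_content F (U i))).
  have oU i : open (U i) by case: (AU i).
  apply: (le_trans _ (open_content_sigma_subadditive oU)).
  apply: outer_content_le_open; first exact: bigcup_open.
  by apply: subset_bigcup => i _; case: (AU i).
by apply: lee_nneseries => i *; [exact: open_content_ge0|case: (AU i) => _ _ /ltW].
Qed.

Definition BM_outer_measure : {outer_measure set X -> \bar R} :=
  HB.pack (outer_content F) (isOuterMeasure.Build R X (outer_content F)
    outer_content0 outer_content_ge0 le_outer_content
    outer_content_sigma_subadditive).

(** For an open [V] containing [A], approximate [V] inside [U] by a closed [K]. The open set [V]
    minus [K] contains the part of [V] outside [U]; approximate it by a closed [L]. As [K] and [L]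
    are disjoint closed subsets of [V], their contents add up to at most that of [V]. All terms
    moved across the inequalities are finite. *)
Lemma open_caratheodory U : open U -> BM_outer_measure.-caratheodory U.
Proof.
move=> oU; apply: le_caratheodory_measurable => A /=.
apply: le_outer_content_inf => V oV AV.
apply: (@le_trans _ _ (open_content F (V `&` U) + outer_content F (V `\` U))).
  apply: leeD; last by apply: le_outer_content => x []; split=> //; exact: AV.
  by apply: outer_content_le_open; [exact: openI|exact: setSI].
rewrite -leeBrDr ?outer_content_fin_num//.
apply: open_content_le => K cK KVU; rewrite leeBrDr ?outer_content_fin_num//.
rewrite addeC -leeBrDr//.
apply: (@le_trans _ _ (open_content F (V `\` K))).
  apply: outer_content_le_open; first by rewrite setDE; apply: openI => //; exact: closed_openC.
  by move=> x [Vx Ux]; split=> // /KVU[].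
apply: open_content_le => L cL LVK; rewrite leeBrDr// -EFinD.
apply: (@le_trans _ _ (bm F (L `|` K))%:E).
  rewrite lee_fin bm_disjoint//.
  by apply/seteqP; split=> // x [/LVK[]].
apply: bm_le_open; first exact: closedU.
by move=> x [/LVK[]|/KVU[]].
Qed.

End OuterMeasure.

(** * The Borel probability measure *)

Section Measure.
Context {R : realType} {X : pmetricType R}.
Hypothesis X_compact : compact [set: X].
Context (F : set_system nat) {F_ultra : UltraFilter F}.
Hypothesis F_nonprincipal : nonprincipal F.
Local Open Scope ereal_scope.

Let mu_outer := @BM_outer_measure R X X_compact F F_ultra.

Lemma borel_caratheodory : (@open X).-sigma.-measurable `<=` mu_outer.-caratheodory.
Proof.
apply: smallest_sub; last exact: open_caratheodory.
split; first exact: caratheodory_measurable_set0.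
- by move=> A mA; rewrite setTD; exact: caratheodory_measurable_setC.
- exact: caratheodory_measurable_bigcup.
Qed.

(* The proof of nonprincipality is an argument so that the measure structure can
   be inferred from the function. *)
Definition BM_measure (_ : nonprincipal F)
    (A : set (g_sigma_algebraType (@open X))) : \bar R := mu_outer A.

Local Notation mu := (BM_measure F_nonprincipal).

Let BM_measure0 : mu set0 = 0. Proof. exact: outer_measure0. Qed.

Let BM_measure_ge0 A : 0 <= mu A. Proof. exact: outer_measure_ge0. Qed.

Let BM_measure_semi_sigma_additive : semi_sigma_additive mu.
Proof.
move=> A mA tA mUA.
apply: (@caratheodory_measure_sigma_additive R X mu_outer A) => //.
  by move=> i; exact: borel_caratheodory.
exact: borel_caratheodory.
Qed.

HB.instance Definition _ := isMeasure.Build _ _ _ mu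
  BM_measure0 BM_measure_ge0 BM_measure_semi_sigma_additive.

Let BM_measureT : mu setT = 1. Proof. exact: outer_contentT. Qed.

HB.instance Definition _ := Measure_isProbability.Build _ _ _ mu BM_measureT.

End Measure.

(** * Congruences: inverses, extension to the closure, Borel images *)

Section Congruence.
Context {R : realType} {X : pmetricType R}.
Implicit Types (A B C : set X) (sigma tau : X -> X).

Lemma sub_congruence_on A B sigma : A `<=` B ->
  congruence_on B sigma -> congruence_on A sigma.
Proof. by move=> AB sB x y /AB Bx /AB By; exact: sB. Qed.

Lemma congruence_on_inj A sigma x y : congruence_on A sigma -> A x -> A y ->
  sigma x = sigma y -> x = y.
Proof.
by move=> sA Ax Ay xy; apply: mdist_positivity; rewrite -sA// xy mdistxx.
Qed.

Lemma congruence_on_inverse A sigma : congruence_on A sigma ->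
  exists tau, congruence_on (sigma @` A) tau /\ {in A, cancel sigma tau}.
Proof.
move=> sA; have sK : {in A, cancel sigma ('pinv_(fun=> point) A sigma)}.
  apply: pinvKV => x y. move=> /set_mem Ax /set_mem Ay; exact: congruence_on_inj sA Ax Ay.
exists ('pinv_(fun=> point) A sigma); split=> // _ _ [x Ax <-] [y Ay <-].
by rewrite sA// !sK ?inE.
Qed.

Lemma congruence_on_compact A sigma : congruence_on A sigma -> compact A ->
  compact (sigma @` A).
Proof.
move=> sA; apply: continuous_compact; apply/subspace_continuousP => x Ax.
apply/metricType_numDomainType.cvgrPdist_lt => e e0.
have : \forall y \near x, ball x e y by exact: nbhsx_ballx.
rewrite near_withinE; apply: filterS => y.
by rewrite ballEmdist/= => xy Ay; rewrite sA.
Qed.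

Lemma mdist_le_add2 (p q x y : X) :
  `|mdist p q - mdist x y| <= mdist p x + mdist q y.
Proof.
have := metric_triangle p x q; have := metric_triangle x y q.
have := metric_triangle x p y; have := metric_triangle p q y.
rewrite ler_norml (metric_sym x p) (metric_sym y q) => *.
by apply/andP; split; lra.
Qed.

Hypothesis X_compact : compact [set: X].

(* The limit of [sigma] at [x] is the point whose distance to each [sigma b]
   is that of [x] to [b]. *)
Lemma congruence_on_limit B sigma x : congruence_on B sigma -> closure B x ->
  exists y, forall b, B b -> mdist y (sigma b) = mdist x b.
Proof.
move=> sB Bx.
have PW : ProperFilter (within B (nbhs x)).
  by apply: within_nbhs_proper.
(* The candidate is a cluster point of [sigma] along [B] near [x]; the filter is proper because [x]
   lies in the closure of [B]. *)
have [//|y [_ yc]] := X_compact (F := sigma @ within B (nbhs x)) _ _.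
  exact: filterT.
exists y => b Bb; apply/eqP; rewrite -subr_eq0 -normr_le0.
apply/ler_addgt0Pl => e e0; rewrite addr0.
have e2 : 0 < e / 2 by rewrite divr_gt0.
have BW : (sigma @ within B (nbhs x)) (sigma @` (B `&` ball x (e / 2))).
  change (\forall z \near x, B z -> (sigma @` (B `&` ball x (e / 2))) (sigma z)).
  by apply: filterS (nbhsx_ballx x _ e2) => z xz Bz; exists z.
(* This [z] in [B] is within [e / 2] of [x] while [sigma z] is within [e / 2] of [y]. As [sigma]
   preserves the distance from [z] to [b], the two errors add up to at most [e]. *)
have [_ [[z [Bz +] <-]]] := yc _ (ball y (e / 2)) BW (nbhsx_ballx _ _ e2).
rewrite !ballEmdist/= => xz yz.
rewrite (le_trans (_ : _ <= `|mdist y (sigma b) - mdist (sigma z) (sigma b)| +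
   `|mdist x b - mdist z b|))//; last first.
  have := mdist_le_add2 y (sigma b) (sigma z) (sigma b).
  have := mdist_le_add2 x b z b.
  by rewrite !mdistxx !addr0; lra.
rewrite (distrC (mdist x b)) sB//.
by apply: (le_trans _ (ler_normD _ _)); rewrite subrKA.
Unshelve. all: by end_near. Qed.

(** The limit points are chosen separately for each point, and their distances to the points
    [sigma b] determine everything: approximating [y] by some [b] in [B] turns the distance of
    [tau x] to [tau y] into that of [tau x] to [sigma b], which is that of [x] to [b]. *)
Lemma congruence_on_closure B sigma : congruence_on B sigma ->
  exists tau, congruence_on (closure B) tau /\ {in B, tau =1 sigma}.
Proof.
move=> sB.
have /choice[tau tauP] : forall x, exists y, closure B x ->
    forall b, B b -> mdist y (sigma b) = mdist x b.
  move=> x; have [Bx|nBx] := pselect (closure B x); last by exists x.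
  by have [y yP] := congruence_on_limit sB Bx; exists y.
exists tau; split=> [x y Bx By|x /set_mem Bx]; last first.
  (* Taking [b] to be [x] itself puts [tau x] at distance 0 from [sigma x]. *)
  by apply: mdist_positivity; rewrite (tauP x)// ?mdistxx//; exact: subset_closure.
apply/eqP; rewrite -subr_eq0 -normr_le0.
apply/ler_addgt0Pl => e e0; rewrite addr0.
have e2 : 0 < e / 2 by rewrite divr_gt0.
have [b [Bb]] := By _ (nbhsx_ballx y _ e2); rewrite ballEmdist/= => yb.
have := mdist_le_add2 (tau x) (tau y) (tau x) (sigma b).
have := mdist_le_add2 x y x b.
rewrite !mdistxx !add0r (tauP x)// (tauP y)// !ler_norml => /andP[? ?] /andP[? ?].
by apply/andP; split; lra.
Qed.

(** After extending [sigma] to the compact closure, the sets whose trace on the closure has a Borel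
    image form a sigma-algebra. Closed sets have compact traces, hence closed images; open sets
    follow by complement. *)
Lemma congruence_borel_image B sigma : (@open X).-sigma.-measurable B ->
  congruence_on B sigma -> (@open X).-sigma.-measurable (sigma @` B).
Proof.
move=> mB /congruence_on_closure[tau [tauB tausigma]].
have clB A : closed A -> (@open X).-sigma.-measurable A.
  move=> cA; rewrite -[A]setCK; apply: measurableC.
  by apply: sub_sigma_algebra; exact: closed_openC.
have image_closed A : closed A -> closed (tau @` (A `&` closure B)).
  move=> cA; apply: compact_closed; first exact: metric_hausdorff.
  apply: congruence_on_compact; first by apply: sub_congruence_on tauB => x [].
  by apply: (subclosed_compact _ X_compact) => //; apply: closedI => //; exact: closed_closure.
(* Injectivity of [tau] on the closure is what makes images commute with complements. *)
have setD_image A : tau @` (~` A `&` closure B) =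
    tau @` ([set: X] `&` closure B) `\` tau @` (A `&` closure B).
  apply/seteqP; split=> [_ [x [Ax Bx] <-]|_ [[x [_ Bx] <-] Ax]].
    split; first by exists x.
    by move=> [y [Ay By] /(congruence_on_inj tauB By Bx) yx]; apply: Ax; rewrite -yx.
  by exists x => //; split=> // {}Ax'; apply: Ax; exists x.
have imgm : (@open X).-sigma.-measurable `<=`
    [set A | (@open X).-sigma.-measurable (tau @` (A `&` closure B))].
  apply: smallest_sub => [|A oA /=].
    split=> /=; first by rewrite set0I image_set0; exact: measurable0.
    - move=> A mA; rewrite setTD setD_image; apply: measurableD => //.
      by apply: clB; apply: image_closed; exact: closedT.
    - by move=> A mA; rewrite setI_bigcupl image_bigcup; exact: bigcup_measurable.
  rewrite -[A]setCK setD_image; apply: measurableD; apply: clB; apply: image_closed.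
    exact: closedT.
  exact: open_closedC.
have -> : sigma @` B = tau @` (B `&` closure B).
  apply/seteqP; split=> [_ [x Bx <-]|_ [x [Bx _] <-]]; exists x => //.
  - by split=> //; exact: subset_closure.
  - by rewrite tausigma ?inE.
  - by rewrite tausigma ?inE.
exact: imgm.
Qed.

End Congruence.

(** * Regular spaces: measure and content agree on closed sets, and invariance follows *)

Section Regular.
Context {R : realType} {X : pmetricType R}.
Hypothesis X_compact : compact [set: X].
Context (F : set_system nat) {F_ultra : UltraFilter F}.
Hypothesis F_nonprincipal : nonprincipal F.
Local Open Scope ereal_scope.

Lemma bm_le_outer (K : set X) : closed K -> (bm F K)%:E <= outer_content F K.
Proof.
by move=> cK; apply: le_outer_content_inf => U _ KU; exact: bm_le_open.
Qed.

(** The union of the open interiors of the balls of radius [r] centred in [K] lies between [K] and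
    its closed neighbourhood. *)
Lemma outer_content_le_nbhd (K : set X) (r : R) : (0 < r)%R ->
  outer_content F K <= BM_content F (closed_nbhd K r).
Proof.
move=> r0; rewrite BM_contentE//.
apply: (@le_trans _ _ (open_content F (\bigcup_(x in K) (ball x r)^°))).
  apply: outer_content_le_open; first by apply: bigcup_open => x _; exact: open_interior.
  by move=> x Kx; exists x => //; exact: nbhsx_ballx.
apply: open_content_bm => // y [x Kx /interior_subset]; rewrite ballEmdist/= => xy.
apply: (@le_trans _ _ (mdist y x)%:E); last by rewrite lee_fin metric_sym ltW.
by apply: ereal_inf_lbound; exists x.
Qed.

Lemma outer_content_regular (K : set X) : BM_regular X F -> closed K ->
  outer_content F K = (bm F K)%:E.
Proof.
move=> Xreg cK; apply/eqP; rewrite eq_le bm_le_outer// andbT.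
(* Vanishing singularity identifies the limit because the subtracted content is finite and can be
   added back. *)
have limE : limn (fun n => BM_content F (closed_nbhd K n.+1%:R^-1)) = (bm F K)%:E.
  have := congr1 (fun x => x + (bm F K)%:E) (Xreg K cK); rewrite add0e /sing BM_contentE//.
  by move=> <-; rewrite subeK.
rewrite -limE; apply: lime_ge; last first.
  by apply: nearW => n; exact: outer_content_le_nbhd.
(* The neighbourhoods shrink as [n] grows, so their contents converge, as the comparison with the
   limit requires. *)
apply: ereal_nonincreasing_is_cvgn => m n mn; rewrite !BM_contentE// lee_fin.
apply: le_bm => // x /le_trans; apply.
by rewrite lee_fin lef_pV2 ?posrE// ler_nat.
Qed.

Let mu : probability _ R := BM_measure X_compact F_nonprincipal.

(** Dual to the outer approximation by open sets: [K] is the complement of an open set that contains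
    the complement of [B] and has almost the same measure. *)
Lemma closed_inner_regular (B : set X) (e : R) : (@open X).-sigma.-measurable B ->
  (0 < e)%R -> exists K, [/\ closed K, K `<=` B & mu B <= mu K + e%:E].
Proof.
move=> mB e0; have [U [oU BU Ue]] := outer_content_adherent X_compact (F := F) (~` B) e0.
exists (~` U); split; first exact: open_closedC.
  by rewrite -[B]setCK; exact: subsetC.
have mU : (@open X).-sigma.-measurable U by exact: sub_sigma_algebra.
rewrite -outer_content_open// in Ue.
move: Ue; rewrite -[outer_content F U]/(mu U) -[outer_content F (~` B)]/(mu (~` B)).
rewrite !probability_setC//.
have /fineK <- := fin_num_measure mu U mU; have /fineK <- := fin_num_measure mu B mB.
rewrite -!EFinB -!EFinD !lte_fin !lee_fin => ?; lra.
Qed.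

Hypothesis X_regular : BM_regular X F.

Lemma BM_measure_le_image (B : set X) (sigma : X -> X) :
  (@open X).-sigma.-measurable B -> congruence_on B sigma -> mu B <= mu (sigma @` B).
Proof.
move=> mB sB; apply/lee_addgt0Pr => e e0.
have [K [cK KB BK]] := closed_inner_regular mB e0.
apply: le_trans BK _; rewrite leeD2r//.
have sK := sub_congruence_on KB sB.
have csK : closed (sigma @` K).
  apply: compact_closed; first exact: metric_hausdorff.
  exact: congruence_on_compact sK (subclosed_compact cK X_compact (@subsetT _ K)).
have [tau [tauK tausigma]] := congruence_on_inverse sK.
apply: (@le_trans _ _ (mu (sigma @` K))); last first.
  by apply: le_outer_content; exact: image_subset.
rewrite [mu K]outer_content_regular// [mu _]outer_content_regular// lee_fin.
(* Congruences do not increase content; applied to the inverse [tau], this bounds the content of [K]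
   by that of its image. *)
have {1}<- : tau @` (sigma @` K) = K; last exact: bm_image.
apply/seteqP; split=> [_ [_ [x Kx <-] <-]|x Kx]; first by rewrite tausigma ?inE.
by exists (sigma x); [exists x|rewrite tausigma ?inE].
Qed.

Lemma BM_measure_congruence (B : set X) (sigma : X -> X) :
  (@open X).-sigma.-measurable B -> congruence_on B sigma -> mu (sigma @` B) = mu B.
Proof.
move=> mB sB; apply/eqP; rewrite eq_le BM_measure_le_image// andbT.
have [tau [tauB tausigma]] := congruence_on_inverse sB.
have {2}<- : tau @` (sigma @` B) = B.
  apply/seteqP; split=> [_ [_ [x Bx <-] <-]|x Bx]; first by rewrite tausigma ?inE.
  by exists (sigma x); [exists x|rewrite tausigma ?inE].
(* The inequality applies to the inverse congruence because its domain, the image of [B], is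
   Borel. *)
by apply: BM_measure_le_image => //; exact: congruence_borel_image.
Qed.

End Regular.

Theorem theorem5p2 (R : realType) (X : pmetricType R)
    (X_compact : compact [set: X])
    (F : set_system nat) (F_ultra : UltraFilter F) (F_nonprincipal : nonprincipal F)
    (X_regular : BM_regular X F) :
  exists mu : probability (g_sigma_algebraType (@open X)) R,
    (forall B : set X, (@open X).-sigma.-measurable B ->
       mu B = outer_content F B) /\
    (forall (B : set X) (sigma : X -> X),
       (@open X).-sigma.-measurable B -> congruence_on B sigma ->
       (@open X).-sigma.-measurable (sigma @` B) /\ mu (sigma @` B) = mu B).
Proof.
exists (BM_measure X_compact F_nonprincipal); split=> // B sigma mB sB.
split; first exact: congruence_borel_image.
exact: BM_measure_congruence.
Qed.
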